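(* Let $(\sigma_n)_{n\ge 1}$ be a sequence of positive real numbers, and consider the time-dependent Pólya urn with reinforcement sequence $(\sigma_n)$, with $T_0$ initial white balls and $\tau_0$ initial balls in total. Let $\mathcal{M}$ and $\mathcal{D}$ be the monopoly and domination events of this urn. If $\sigma_n\to0$ as $n\to\infty$, then $\mathbb{P}(\mathcal{M})=\mathbb{P}(\mathcal{D})=0$.
   Context: Time-dependent Pólya urn: let $(\sigma_n)_{n\ge1}$ be a deterministic sequence of positive real numbers (not necessarily integers), let $\tau_0$ (initial total number of balls) and $T_0$ (initial number of white balls) be deterministic integers with $1\le T_0\le \tau_0-1$ (at least one white and one black ball initially), and set $\tau_n=\tau_0+\sum_{i=1}^n\sigma_i$ for $n\ge 0$. The random processes $(I_n)_{n\ge1}$, $(T_n)_{n\ge 0}$, $(\Theta_n)_{n\ge 0}$ are defined recursively on a probability space by $\Theta_n=T_n/\tau_n$ and $T_{n+1}=T_n+\sigma_{n+1}I_{n+1}$, where, conditionally on $\mathcal{F}_n=\sigma(I_1,\dots,I_n)$ (the generated $\sigma$-algebra), $I_{n+1}$ is a Bernoulli random variable with parameter $\Theta_n$, i.e. $I_{n+1}\in\{0,1\}$ and $\mathbb{P}(I_{n+1}=1\mid\mathcal{F}_n)=\Theta_n$. The process $(\Theta_n)$ is a bounded martingale and hence converges almost surely to a random variable denoted $\Theta$. Domination event: $\mathcal{D}=\{\Theta=0\}\cup\{\Theta=1\}$. Monopoly event: $\mathcal{M}=\{I_n=0 \text{ for all sufficiently large } n\}\cup\{I_n=1\text{ for all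 sufficiently large } n\}$. *)

(* Defs.v *)
From HB Require Import structures.
From mathcomp Require Import all_boot all_order all_algebra.
From mathcomp Require Import all_classical all_reals all_analysis.
Set Implicit Arguments.
Unset Strict Implicit.
Unset Printing Implicit Defensive.
Import Order.TTheory GRing.Theory Num.Theory.
Import numFieldNormedType.Exports.
Local Open Scope classical_set_scope.
Local Open Scope ring_scope.

(* [X] is a version of P(E | G), for a sub-sigma-algebra [G] given as a set
   of subsets; the first condition is the G-measurability of [X]. *)
Definition is_cond_prob (R : realType) (d : measure_display)
    (Omega : measurableType d) (P : probability Omega R)
    (G : set (set Omega)) (E : set Omega) (X : Omega -> R) : Prop :=
  [/\ preimage_set_system setT X measurable `<=` G,
      P.-integrable setT (EFin \o X) &
      forall A, G A -> (\int[P]_(w in A) (X w)%:E = P (A `&` E))%E].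

Section urn.
Variables (R : realType) (d : measure_display) (Omega : measurableType d).
Variables (P : probability Omega R).

(* [sigma] and [I] are indexed from 1: [sigma 0] and [I 0] are never used. *)
Variables (sigma : nat -> R) (tau0 T0 : nat).
Implicit Types I : nat -> {RV P >-> R}.

Definition urn_total (n : nat) : R :=
  tau0%:R + \sum_(1 <= i < n.+1) sigma i.

Fixpoint urn_white I (n : nat) (w : Omega) : R :=
  if n is m.+1 then urn_white I m w + sigma m.+1 * I m.+1 w else T0%:R.

Definition urn_proportion I (n : nat) (w : Omega) : R :=
  urn_white I n w / urn_total n.

Definition urn_history I (n : nat) : set (set Omega) :=
  <<s \bigcup_(i in [set i : nat | (1 <= i <= n)%N])
        preimage_set_system setT (I i) measurable >>.

Definition polya_urn I : Prop := forall n,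
  (forall w, I n.+1 w = 0 \/ I n.+1 w = 1) /\
  is_cond_prob P (urn_history I n) [set w | I n.+1 w = 1]
    (urn_proportion I n).

Definition urn_limit I (Theta : {RV P >-> R}) : Prop :=
  {ae P, forall w, urn_proportion I n w @[n --> \oo] --> Theta w}.

Definition monopoly I : set Omega :=
  [set w | \forall n \near \oo, I n w = 0] `|`
  [set w | \forall n \near \oo, I n w = 1].

Definition domination (Theta : {RV P >-> R}) : set Omega :=
  [set w | Theta w = 0] `|` [set w | Theta w = 1].

End urn.

(* Main.v *)
(* Fix one colour, let X_n be its total weight and tau_n the total weight of the
   urn. With s = 1/2 and n so large that all later sigma are at most s,
   (tau_n - s) / (X_n - s) is a supermartingale (a martingale when sigma = s),
   and X_n >= 1 makes it bounded at the first such time. It dominates the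
   inverse of theta_n = X_n / tau_n, so by Markov P(theta_n <= e) <= C * e
   uniformly in n, whence theta_n -> 0 has probability 0.
   If the colour is never drawn after some history b, then the probability q_m
   of b followed by m draws of the other colour satisfies q_m <= C * theta_m and
   q_(m+1) = (1 - theta_m) * q_m, which forces q_m -> 0; there are countably
   many b. Both colours are covered by exchanging their roles. *)
Require Import Defs.
From HB Require Import structures.
From mathcomp Require Import all_boot all_order all_algebra.
From mathcomp Require Import all_classical all_reals all_analysis.
From mathcomp Require Import ring lra.
Import Order.TTheory GRing.Theory Num.Theory.
Import numFieldNormedType.Exports.
Set Implicit Arguments.
Unset Strict Implicit.
Unset Printing Implicit Defensive.
Local Open Scope classical_set_scope.
Local Open Scope ring_scope.

(** * Histories of a single colour and their probabilities *)

Section colour.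
Context (R : realType) (d : measure_display) (Omega : measurableType d).
Context (P : probability Omega R).
Context (sigma : nat -> R) (tau0 x0 : nat).
Implicit Types (draw : nat -> Omega -> bool) (b : seq bool) (n : nat).

Local Notation tau := (urn_total sigma tau0).

(* The most recent draw comes first, so that the draw at the head of a history
   of length [n] is the [n]-th one. *)
Fixpoint history draw n (w : Omega) : seq bool :=
  if n is m.+1 then draw m.+1 w :: history draw m w else [::].

Definition cylinder draw b : set Omega :=
  [set w | history draw (size b) w = b].

(** Here [size b] includes the head draw, so each draw is weighted by the reinforcement of its own
    step. *)
Fixpoint colour_count b : R :=
  if b is c :: b' then colour_count b' + (if c then sigma (size b) else 0)
  else x0%:R.

Definition colour_proportion b : R := colour_count b / tau (size b).

(** The conditional law of the next draw, tested only on the atoms of the past. All later estimates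
    become finite computations on cylinders, and the condition can be transferred to the other
    colour. *)
Definition colour_law draw : Prop := forall b,
  P (cylinder draw b `&` [set w | draw (size b).+1 w]) =
    ((colour_proportion b)%:E * P (cylinder draw b))%E.

Lemma size_history draw n w : size (history draw n w) = n.
Proof. by elim: n => //= n ->. Qed.

Lemma urn_totalS n : tau n.+1 = tau n + sigma n.+1.
Proof. by rewrite /urn_total big_nat_recr//= addrA. Qed.

Lemma urn_total0 : tau 0 = tau0%:R.
Proof. by rewrite /urn_total big_geq// addr0. Qed.

(** * Estimates for one colour *)

Section draw.
Variable draw : nat -> Omega -> bool.
Hypothesis sigma_pos : forall n, (1 <= n)%N -> 0 < sigma n.
Hypotheses (x0_pos : (1 <= x0)%N) (x0_le : (x0 <= tau0)%N).
Hypothesis mdraw : forall n, (1 <= n)%N -> measurable [set w | draw n w].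
Hypothesis law : colour_law draw.

Local Notation cyl := (cylinder draw).
Local Notation hist := (history draw).
Local Notation theta := colour_proportion.
Local Notation p A := (fine (P A)).

Lemma colour_count_ge1 b : 1 <= colour_count b.
Proof.
elim: b => [|c b IH] /=; first by rewrite ler1n.
by case: c; rewrite ?addr0// -[leLHS]addr0 lerD// ltW// sigma_pos.
Qed.

Lemma colour_count_le b : colour_count b <= tau (size b).
Proof.
elim: b => [|c b IH] /=; first by rewrite urn_total0 ler_nat.
by rewrite urn_totalS lerD//; case: c => //; rewrite ltW// sigma_pos.
Qed.

Lemma urn_total_ge1 n : 1 <= tau n.
Proof.
elim: n => [|n IH]; first by rewrite urn_total0 ler1n (leq_trans x0_pos).
by rewrite urn_totalS -[leLHS]addr0 lerD// ltW// sigma_pos.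
Qed.

Lemma colour_proportion_gt0 b : 0 < theta b.
Proof.
rewrite divr_gt0//; first exact: lt_le_trans (colour_count_ge1 b).
exact: lt_le_trans (urn_total_ge1 _).
Qed.

Lemma colour_proportion_le1 b : theta b <= 1.
Proof.
rewrite ler_pdivrMr ?mul1r ?colour_count_le//.
exact: lt_le_trans (urn_total_ge1 _).
Qed.

Lemma cylinder_cons c b :
  cyl (c :: b) = cyl b `&` [set w | draw (size b).+1 w = c].
Proof.
by apply/seteqP; split => w; rewrite /cylinder/=; [case|move=> [-> ->]].
Qed.

Lemma measurable_drawE n c : (1 <= n)%N -> measurable [set w | draw n w = c].
Proof.
move=> n1; case: c; first exact: mdraw.
rewrite (_ : [set _ | _] = ~` [set w | draw n w]).
  by apply: measurableC; exact: mdraw.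
by apply/seteqP; split => w /=; [move=> -> | move/negP/negbTE].
Qed.

Lemma measurable_cylinder b : measurable (cyl b).
Proof.
elim: b => [|c b IH].
  by rewrite (_ : cyl [::] = setT)//; apply/seteqP; split.
by rewrite cylinder_cons; apply: measurableI => //; exact: measurable_drawE.
Qed.

(** Splitting on the newest draw leaves a condition on the shorter history, so the induction must
    range over all [Q]. *)
Lemma measurable_history n (Q : pred (seq bool)) :
  measurable [set w | Q (hist n w)].
Proof.
elim: n Q => [|n IH] Q /=.
  have [Q0|nQ0] := boolP (Q [::]).
    by rewrite (_ : [set _ | _] = setT)//; apply/seteqP; split.
  by rewrite (_ : [set _ | _] = set0)//; apply/seteqP; split.
rewrite (_ : [set _ | _] =
    ([set w | draw n.+1 w = true] `&` [set w | Q (true :: hist n w)]) `|`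
    ([set w | draw n.+1 w = false] `&` [set w | Q (false :: hist n w)])).
  apply: measurableU; apply: measurableI; try exact: measurable_drawE.
    exact: IH (fun b => Q (true :: b)).
  exact: IH (fun b => Q (false :: b)).
apply/seteqP; split => w /=; last by case=> -[->].
by case: (draw n.+1 w); [left|right].
Qed.

Lemma fineK_probability A : measurable A -> P A = (p A)%:E.
Proof. by move=> mA; rewrite fineK// fin_num_measure. Qed.

Lemma le_fine_probability A B :
  measurable A -> measurable B -> A `<=` B -> p A <= p B.
Proof.
by move=> mA mB AB; rewrite -lee_fin -!fineK_probability// le_measure// inE.
Qed.

Lemma fine_cylinder_cons c b :
  p (cyl (c :: b)) = (if c then theta b else 1 - theta b) * p (cyl b).
Proof.
have mb := measurable_cylinder b.
have mD : measurable [set w | draw (size b).+1 w] by exact: mdraw.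
have E1 : p (cyl (true :: b)) = theta b * p (cyl b).
  by rewrite cylinder_cons law fineK_probability// -EFinM.
case: c => //; rewrite mulrBl mul1r -E1; apply/eqP; rewrite eq_sym subr_eq.
apply/eqP/EFin_inj; rewrite EFinD -!fineK_probability;
  try exact: measurable_cylinder.
rewrite -measureU//; try exact: measurable_cylinder.
  rewrite !cylinder_cons -setIUr (_ : _ `|` _ = setT) ?setIT//.
  by apply/seteqP; split => w //= _; case: draw; [right|left].
by rewrite !cylinder_cons; apply/seteqP; split => w //= [[_ ->]] [_].
Qed.

(** Markov's inequality at time [n] for a supermartingale started from [b], by backward induction on
    the number [n - size b] of draws left: the cylinder splits according to the next draw, and [u]
    does not increase on average. *)
Lemma supermartingale_markov (u : seq bool -> R) (K : R) n b :
  (forall b, 0 <= u b) -> 0 <= K ->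
  (forall b, theta b * u (true :: b) + (1 - theta b) * u (false :: b) <= u b) ->
  (size b <= n)%N ->
  K * p (cyl b `&` [set w | K <= u (hist n w)]) <= u b * p (cyl b).
Proof.
move=> u0 K0 usup /subnK.
have mH c : measurable (cyl c `&` [set w | K <= u (hist n w)]).
  apply: measurableI; first exact: measurable_cylinder.
  exact: (measurable_history _ (fun b => K <= u b)).
move: (n - size b)%N => k; elim: k b => [|k IH] b kbn.
  (* No draw is left: [u] equals [u b] on the whole cylinder, so the event is either all of it or
     empty. *)
  have [Ku|uK] := leP K (u b).
    apply: ler_pM => //; first by rewrite fine_ge0.
    by apply: le_fine_probability => //; exact: measurable_cylinder.
  rewrite (_ : _ `&` _ = set0) ?measure0 ?mulr0 ?mulr_ge0 ?fine_ge0//.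
  by apply/seteqP; split => w //= -[bw]; rewrite -kbn add0n bw leNgt uK.
apply: le_trans (ler_wpM2r (fine_ge0 (measure_ge0 P (cyl b))) (usup b)).
have {IH}IH c : K * p (cyl (c :: b) `&` [set w | K <= u (hist n w)]) <=
    u (c :: b) * p (cyl (c :: b)) by apply: IH; rewrite addnS.
have := lerD (IH true) (IH false); rewrite !fine_cylinder_cons => IH'.
rewrite [leRHS](_ : _ = u (true :: b) * (theta b * p (cyl b)) +
    u (false :: b) * ((1 - theta b) * p (cyl b))); last by ring.
apply: le_trans IH'; rewrite -mulrDr ler_wpM2l//.
rewrite -lee_fin EFinD -!fineK_probability//.
apply: le_trans (measureU2 _ (mH _) (mH _)).
rewrite le_measure ?inE//; first exact: measurableU.
rewrite !cylinder_cons => w [/= bw Kw]; case: (boolP (draw (size b).+1 w)) => D.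
  by left.
by right; split => //; split => //; exact/negbTE.
Qed.

Lemma colour_proportion_tail :
  sigma n @[n --> \oo] --> (0 : R) ->
  exists (C : R) n0, 0 < C /\ forall n (e : R), (n0 <= n)%N -> 0 < e ->
    p [set w | theta (hist n w) <= e] <= C * e.
Proof.
(* What matters is [0 < s < 1]: positivity lets [s] bound [sigma] eventually, and [s < 1] keeps
   [colour_count b - s] positive. *)
move=> s0; pose s : R := 2^-1.
have s1 : s < 1 by rewrite invf_lt1 ?ltr1n.
have s_gt0 : 0 < s by rewrite invr_gt0.
have [n0 sn0] : exists n0, forall n, (n0 <= n)%N -> sigma n.+1 <= s.
  move/cvgrPdist_le : s0 => /(_ s s_gt0)[n0 _ H]; exists n0 => n n0n.
  by have := H n.+1 (leqW n0n); rewrite sub0r normrN; exact/le_trans/ler_norm.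
(* [C] bounds the ratio at time [n0], because the colour count is at least 1. Freezing [u] at [C]
   before [n0] preserves the supermartingale inequality and gives [u [::] <= C]. *)
pose C := (tau n0 - s) / (1 - s).
pose u b := if (size b < n0)%N then C else
  (tau (size b) - s) / (colour_count b - s).
have C_gt0 : 0 < C.
  by rewrite divr_gt0 ?subr_gt0//; exact: lt_le_trans (urn_total_ge1 _).
exists C, n0; split => // n e n0n e0.
have ts b : 0 < tau (size b) - s.
  by rewrite subr_gt0; exact: lt_le_trans (urn_total_ge1 _).
have cs b : 0 < colour_count b - s.
  by rewrite subr_gt0; exact: lt_le_trans (colour_count_ge1 _).
have u0 b : 0 <= u b.
  by rewrite /u; case: ifP => _; [exact: ltW | rewrite divr_ge0// ltW].
have uC b : (size b <= n0)%N -> u b <= C.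
  rewrite leq_eqVlt /u => /orP[/eqP ->|->//]; rewrite ltnn.
  rewrite ler_wpM2l//; last first.
    by rewrite lef_pV2 ?posrE ?cs ?subr_gt0// lerD2r colour_count_ge1.
  by rewrite ltW// subr_gt0; exact: lt_le_trans (urn_total_ge1 _).
have usup b :
    theta b * u (true :: b) + (1 - theta b) * u (false :: b) <= u b.
  have [bn0|n0b] := ltnP (size b) n0.
    rewrite [leRHS]/u bn0 (_ : C = theta b * C + (1 - theta b) * C); last first.
      by rewrite -mulrDl addrC subrK mul1r.
    rewrite lerD// ler_wpM2l ?uC// ?subr_ge0 ?colour_proportion_le1//.
    exact/ltW/colour_proportion_gt0.
  rewrite /u /= !ltnNge n0b (leqW n0b)/= addr0 urn_totalS /theta.
  have := sn0 _ n0b; have := cs b; have := ts b; have := colour_count_le b.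
  have := sigma_pos (ltn0Sn (size b)).
  move: (tau _) (sigma _) (colour_count _) => t a x a0 xt ts' xs as'.
  have t0 : 0 < t by lra.
  have xa : 0 < x + a - s by lra.
  (* The exact expected one-step decrease of [u]; its sign is that of [s - a], which is nonnegative
     from [n0] on. *)
  rewrite -subr_ge0 (_ : _ - _ =
      a * (s - a) * (t - x) / (t * (x + a - s) * (x - s))); last first.
    by field; rewrite !gt_eqF.
  by rewrite divr_ge0 ?mulr_ge0//; lra.
have := @supermartingale_markov u e^-1 n [::] u0 (ltW _) usup (leq0n _).
rewrite invr_gt0 => /(_ e0).
rewrite (_ : cyl [::] = setT); last by apply/seteqP; split.
rewrite setTI probability_setT mulr1 => H.
apply: (@le_trans _ _ (p [set w | e^-1 <= u (hist n w)])); last first.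
  rewrite -ler_pdivrMr// mulrC; apply: le_trans H _.
  exact: uC.
apply: le_fine_probability.
- exact: (measurable_history _ (fun b => theta b <= e)).
- exact: (measurable_history _ (fun b => e^-1 <= u b)).
move=> w /= we; rewrite /u size_history ltnNge n0n /=.
(* Since [x <= t], subtracting [s] from both can only increase the ratio:
   [t / x <= (t - s) / (x - s)]. *)
apply: (@le_trans _ _ (theta (hist n w))^-1).
  by rewrite lef_pV2 ?posrE// colour_proportion_gt0.
rewrite invf_div size_history.
have := cs (hist n w); have := colour_count_le (hist n w).
rewrite size_history; move: (tau _) (colour_count _) => t x xt xs.
have x_gt0 : 0 < x by lra.
rewrite ler_pdivlMr// mulrAC ler_pdivrMr//.
nra.
Qed.

(** Convergence to 0 forces the proportion to stay below each [k.+1%:R^-1] from some time on. The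
    tail bound is uniform in time, so this event has probability at most [C] times that level, for
    every [k]. *)
Lemma colour_proportion_cvg0_negligible :
  sigma n @[n --> \oo] --> (0 : R) ->
  P.-negligible [set w | theta (hist n w) @[n --> \oo] --> (0 : R)].
Proof.
move=> /colour_proportion_tail[C [n0 [C0 tail]]].
pose L e N :=
  \bigcap_(n in [set n | (N <= n)%N]) [set w | theta (hist n w) <= e].
have mT n e : measurable [set w | theta (hist n w) <= e].
  exact: (measurable_history _ (fun b => theta b <= e)).
have mL e N : measurable (L e N).
  by apply: bigcap_measurable => //; exists N => /=.
have mU e : measurable (\bigcup_N L e N) by exact: bigcupT_measurable.
have PU e : 0 < e -> p (\bigcup_N L e N) <= C * e.
  move=> e0; rewrite -lee_fin -fineK_probability//.
  have ndL : {homo L e : n m / (n <= m)%N >-> (n <= m)%O}.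
    move=> N M NM; rewrite subsetEset => w Lw n /= Mn.
    by apply: Lw => /=; exact: leq_trans Mn.
  (* Continuity from below in [N]; each [L e N] lies in the single-time event at [maxn N n0], where
     the tail bound applies. *)
  have /cvg_lim <- // := nondecreasing_cvg_mu (mu := P) (mL e) (mU e) ndL.
  apply: lime_le.
    by apply/cvg_ex; eexists; exact: nondecreasing_cvg_mu.
  apply: nearW => N /=; rewrite fineK_probability// lee_fin.
  apply: le_trans (tail (maxn N n0) e (leq_maxr _ _) e0).
  by apply: le_fine_probability => // w; apply => /=; exact: leq_maxl.
have mA : measurable (\bigcap_k \bigcup_N L k.+1%:R^-1 N).
  exact: bigcapT_measurable.
exists (\bigcap_k \bigcup_N L k.+1%:R^-1 N); split => //.
  rewrite fineK_probability//; congr EFin; apply/eqP.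
  rewrite eq_le fine_ge0// andbT.
  apply/ler_addgt0Pr => e e0; rewrite add0r.
  have [k Ck] : exists k, C * k.+1%:R^-1 <= e.
    exists (Num.bound (C / e)); rewrite ler_pdivrMr// mulrC -ler_pdivrMr//.
    have := archi_boundP (ltW (divr_gt0 C0 e0)).
    by move=> /ltW /le_trans; apply; rewrite ler_nat.
  apply: le_trans Ck; apply: le_trans (PU _ _); last by rewrite invr_gt0.
  by apply: le_fine_probability => // w; exact.
move=> w /= /cvgrPdist_le w0 k _.
have /w0[N _ wN] : 0 < k.+1%:R^-1 :> R by rewrite invr_gt0.
exists N => // n /= /wN; rewrite /= sub0r normrN.
exact/le_trans/ler_norm.
Qed.

Lemma colour_missing_from_negligible b :
  sigma n @[n --> \oo] --> (0 : R) ->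
  P.-negligible (\bigcap_m cyl (nseq m false ++ b)).
Proof.
move=> /colour_proportion_tail[C [n0 [C0 tail]]].
set A := \bigcap_m _; pose q m := p (cyl (nseq m false ++ b)).
have mA : measurable A.
  by apply: bigcapT_measurable => m; exact: measurable_cylinder.
exists A; split => //; rewrite fineK_probability//; congr EFin; apply/eqP.
apply: contraT => pA_neq0.
have pA : 0 < p A by rewrite lt_neqAle eq_sym pA_neq0 fine_ge0.
have qA m : p A <= q m.
  apply: le_fine_probability => //; first exact: measurable_cylinder.
  by move=> w; exact.
(* On the cylinder of [bm] the proportion is the constant [theta bm], so the tail bound at level
   [theta bm] bounds [q m], hence [p A]. *)
have qC m : (n0 <= m)%N -> p A / C <= theta (nseq m false ++ b).
  move=> n0m; rewrite ler_pdivrMr// mulrC; apply: le_trans (qA m) _.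
  set bm := nseq m false ++ b.
  have n0b : (n0 <= size bm)%N.
    by rewrite size_cat size_nseq (leq_trans n0m) ?leq_addr.
  apply: le_trans (tail _ _ n0b (colour_proportion_gt0 bm)).
  apply: le_fine_probability; first exact: measurable_cylinder.
    exact: (measurable_history _ (fun b => theta b <= theta bm)).
  by move=> w /= ->.
(* Each further missed draw lowers [q] by [theta * q], which is at least [p A / C * p A]. *)
have qS k : q (n0 + k)%N <= 1 - k%:R * (p A / C * p A).
  elim: k => [|k IH].
    by rewrite mul0r subr0 -lee_fin -fineK_probability ?probability_le1//;
      exact: measurable_cylinder.
  rewrite addnS /q /= fine_cylinder_cons -/(q _).
  have := ler_pM (divr_ge0 (ltW pA) (ltW C0)) (ltW pA) (qC _ (leq_addr k n0))
    (qA (n0 + k)%N).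
  move=> H; rewrite -natr1 (mulrDl k%:R) mul1r opprD addrA mulrBl mul1r.
  exact: lerB.
have d0 : 0 < p A / C * p A by rewrite mulr_gt0// divr_gt0.
(* After this many steps the upper bound on [q] is negative, contradicting [0 < p A <= q]. *)
have := le_trans (qA _) (qS (Num.bound (p A / C * p A)^-1)).
have := archi_boundP (ltW (_ : 0 < (p A / C * p A)^-1)).
rewrite invr_gt0 => /(_ d0).
rewrite -(ltr_pM2r d0) mulVf ?gt_eqF// => H1 H2.
by have := lt_le_trans pA H2; rewrite subr_gt0 ltNge ltW.
Qed.

Lemma colour_eventually_missing_negligible :
  sigma n @[n --> \oo] --> (0 : R) ->
  P.-negligible [set w | \forall n \near \oo, draw n w = false].
Proof.
move=> s0; pose F k :=
  if unpickle k is Some b then \bigcap_m cyl (nseq m false ++ b) else set0.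
apply: (@negligibleS _ _ _ P (\bigcup_k F k)); last first.
  apply: negligible_bigcup => k; rewrite /F; case: unpickle => [b|].
    exact: colour_missing_from_negligible.
  exact: negligible_set0.
(* The history at a time [N] after which the colour is absent selects one of countably many null
   events. *)
move=> w [N _ wN]; exists (pickle (hist N w)) => //.
rewrite /F pickleK => m _; rewrite /cylinder/= size_cat size_nseq size_history.
elim: m => //= m ->; congr (_ :: _).
by apply: wN => /=; rewrite leqW// leq_addl.
Qed.

End draw.
End colour.

(** * Exchanging the two colours *)

Section swap.
Context (R : realType) (d : measure_display) (Omega : measurableType d).
Context (P : probability Omega R) (sigma : nat -> R) (tau0 x0 : nat).
Context (draw : nat -> Omega -> bool).
Hypothesis sigma_pos : forall n, (1 <= n)%N -> 0 < sigma n.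
Hypotheses (x0_pos : (1 <= x0)%N) (x0_le : (x0 <= tau0)%N).
Hypothesis mdraw : forall n, (1 <= n)%N -> measurable [set w | draw n w].
Hypothesis law : colour_law P sigma tau0 x0 draw.

Let swap n w := ~~ draw n w.

Lemma history_swap n w :
  history swap n w = map negb (history draw n w).
Proof. by elim: n => //= n ->. Qed.

Lemma colour_proportion_swap b :
  colour_proportion sigma tau0 (tau0 - x0) (map negb b) =
  1 - colour_proportion sigma tau0 x0 b.
Proof.
have cE : colour_count sigma (tau0 - x0) (map negb b) =
    urn_total sigma tau0 (size b) - colour_count sigma x0 b.
  elim: b => /= [|c b ->]; first by rewrite urn_total0 natrB.
  by rewrite urn_totalS size_map; case: c => /=; ring.
rewrite /colour_proportion cE size_map mulrBl divff// gt_eqF//.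
exact: lt_le_trans (urn_total_ge1 sigma_pos x0_pos x0_le _).
Qed.

Lemma cylinder_swap b : cylinder swap (map negb b) = cylinder draw b.
Proof.
rewrite /cylinder size_map; apply/seteqP; split => w /=; rewrite history_swap.
  by move/(inj_map negb_inj).
by move->.
Qed.

(** Negating a history keeps its cylinder and complements its proportion, so the law follows by
    taking the complement of the next draw inside the cylinder. *)
Lemma colour_law_swap : colour_law P sigma tau0 (tau0 - x0) swap.
Proof.
move=> b'; rewrite -[b'](mapK negbK); move: (map negb b') => {b'} b.
rewrite cylinder_swap colour_proportion_swap size_map.
have mb : measurable (cylinder draw b) by exact: measurable_cylinder.
have mD := mdraw (ltn0Sn (size b)).
rewrite (_ : _ `&` _ = cylinder draw b `\` [set w | draw (size b).+1 w]).
  rewrite measureD//; last by rewrite ltey_eq fin_num_measure.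
  rewrite [X in (_ - X)%E](law b) [X in (X - _)%E](fineK_probability P mb).
  by rewrite (fineK_probability P mb) -!EFinM -EFinB mulrBl mul1r.
by apply/seteqP; split => w /= [? /negP].
Qed.

End swap.

(** * From the urn to the law of the white draws *)

Section urn.
Context (R : realType) (d : measure_display) (Omega : measurableType d).
Context (P : probability Omega R) (sigma : nat -> R) (tau0 T0 : nat).
Context (I : nat -> {RV P >-> R}).
Hypothesis urn : polya_urn sigma tau0 T0 I.

Definition white_drawn n w := I n w == 1.

Lemma white_drawnE n w : (1 <= n)%N -> I n w = (white_drawn n w)%:R.
Proof.
by case: n => // n _; rewrite /white_drawn; case: (urn n) => /(_ w)[] -> _;
  rewrite ?eqxx// eq_sym oner_eq0.
Qed.

Lemma white_drawn_preimage n :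
  [set w | white_drawn n w] = setT `&` I n @^-1` [set 1].
Proof. by rewrite setTI; apply/seteqP; split => w /= /eqP. Qed.

Lemma measurable_white_drawn n : measurable [set w | white_drawn n w].
Proof. by rewrite white_drawn_preimage; exact: measurable_funP. Qed.

Lemma urn_whiteE n w :
  urn_white sigma T0 I n w = colour_count sigma T0 (history white_drawn n w).
Proof.
elim: n => //= n ->; rewrite white_drawnE// size_history.
by case: white_drawn; rewrite ?mulr1// mulr0.
Qed.

Lemma urn_proportionE n w : urn_proportion sigma tau0 T0 I n w =
  colour_proportion sigma tau0 T0 (history white_drawn n w).
Proof.
by rewrite /urn_proportion urn_whiteE /colour_proportion size_history.
Qed.

(** Makes cylinders admissible test sets in [is_cond_prob]. *)
Lemma urn_history_cylinder n b : (size b <= n)%N ->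
  urn_history I n (cylinder white_drawn b).
Proof.
rewrite /urn_history; set G := \bigcup_(i in _) _.
pose mG := @measurable _ (g_sigma_algebraType G).
elim: b => [|c b IH] /= bn.
  rewrite (_ : cylinder _ _ = setT).
    exact: (@measurableT _ (g_sigma_algebraType G)).
  by apply/seteqP; split.
rewrite cylinder_cons.
apply: (@measurableI _ (g_sigma_algebraType G)); first exact: IH (ltnW bn).
have mD : mG [set w | white_drawn (size b).+1 w].
  apply: sub_sigma_algebra; exists (size b).+1 => //.
  by rewrite white_drawn_preimage; exists [set 1].
case: c => //.
rewrite (_ : [set _ | _] = ~` [set w | white_drawn (size b).+1 w]).
  exact: (@measurableC _ (g_sigma_algebraType G)).
by apply/seteqP; split => w /=; [move=> -> | move/negP/negbTE].
Qed.

(** The proportion is constant on a cylinder, so its integral there is that constant times the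
    probability of the cylinder. *)
Lemma white_colour_law : colour_law P sigma tau0 T0 white_drawn.
Proof.
move=> b; have [_ [_ _ condP]] := urn (size b).
have mb : measurable (cylinder white_drawn b).
  by apply: measurable_cylinder => n _; exact: measurable_white_drawn.
rewrite -integral_cst//.
transitivity (P (cylinder white_drawn b `&` [set w | I (size b).+1 w = 1])).
  by congr (P (_ `&` _)); apply/seteqP; split => w /= /eqP.
rewrite -condP; last exact: urn_history_cylinder.
apply: eq_integral => w; rewrite inE /= => bw.
by rewrite urn_proportionE bw.
Qed.

Lemma measurable_monopoly : measurable (monopoly I).
Proof.
have mE c : measurable [set w | \forall n \near \oo, I n w = c].
  rewrite (_ : [set _ | _] =
    \bigcup_N \bigcap_(n in [set n | (N <= n)%N]) (setT `&` I n @^-1` [set c])).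
    apply: bigcupT_measurable => N; apply: bigcap_measurable.
      by exists N => /=.
    by move=> n _; exact: measurable_funP.
  apply/seteqP; split => w /=.
    by move=> [N _ wN]; exists N => // n /= /wN.
  by move=> [N _ wN]; exists N => // n /= /wN [].
exact: measurableU.
Qed.

Lemma measurable_domination (Theta : {RV P >-> R}) :
  measurable (domination Theta).
Proof.
have mE c : measurable [set w | Theta w = c].
  rewrite (_ : [set _ | _] = setT `&` Theta @^-1` [set c]).
    exact: measurable_funP.
  by rewrite setTI.
exact: measurableU.
Qed.

End urn.

(** * Both events covered by null events of the two colours *)

Theorem theorem1p3 (R : realType) (d : measure_display)
    (Omega : measurableType d) (P : probability Omega R)
    (sigma : nat -> R) (tau0 T0 : nat)
    (I : nat -> {RV P >-> R}) (Theta : {RV P >-> R})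
    (sigma_pos : forall n, (1 <= n)%N -> 0 < sigma n)
    (T0_pos : (1 <= T0)%N) (T0_lt : (T0 < tau0)%N)
    (urn : polya_urn sigma tau0 T0 I)
    (Theta_lim : urn_limit sigma tau0 T0 I Theta)
    (sigma_to0 : sigma n @[n --> \oo] --> (0 : R)) :
  P (monopoly I) = 0%E /\ P (domination Theta) = 0%E.
Proof.
have mW n (_ : (1 <= n)%N) := measurable_white_drawn I n.
have law := white_colour_law urn.
have mB n : (1 <= n)%N -> measurable [set w | ~~ white_drawn I n w].
  move=> n1; rewrite (_ : [set _ | _] = ~` [set w | white_drawn I n w]).
    by apply: measurableC; exact: mW.
  by apply/seteqP; split => w /= /negP.
have lawB := colour_law_swap sigma_pos T0_pos (ltnW T0_lt) mW law.
have B_pos : (1 <= tau0 - T0)%N by rewrite subn_gt0.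
have B_le : (tau0 - T0 <= tau0)%N by exact: leq_subr.
split; (apply/negligibleP;
  [exact: measurable_monopoly || exact: measurable_domination|]).
  (* Draws eventually all 0 mean that white is missing; draws eventually all 1 mean that black is
     missing. *)
  apply: negligibleU.
    apply: negligibleS (colour_eventually_missing_negligible sigma_pos
      T0_pos (ltnW T0_lt) mW law sigma_to0) => w /= [N _ wN].
    exists N => // n /= /wN; rewrite /white_drawn => ->.
    by rewrite eq_sym oner_eq0.
  apply: negligibleS (colour_eventually_missing_negligible sigma_pos
    B_pos B_le mB lawB sigma_to0) => w /= [N _ wN].
  by exists N => // n /= /wN; rewrite /white_drawn => ->; rewrite eqxx.
(* Where the proportion converges to [Theta], the value 0 sends the white proportion to 0 and the
   value 1 sends the black one to 0. *)
apply: (@negligibleS _ _ _ P ((~` [set w |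
    urn_proportion sigma tau0 T0 I n w @[n --> \oo] --> Theta w] `|`
   [set w | colour_proportion sigma tau0 T0 (history (white_drawn I) n w)
      @[n --> \oo] --> (0 : R)]) `|`
   [set w | colour_proportion sigma tau0 (tau0 - T0)
      (history (fun n w => ~~ white_drawn I n w) n w)
      @[n --> \oo] --> (0 : R)])).
  move=> w /=.
  have [cw|] := pselect
    (urn_proportion sigma tau0 T0 I n w @[n --> \oo] --> Theta w);
    last by move=> ncw _; left; left.
  move: cw; rewrite (_ : (fun n => _) = (fun n =>
    colour_proportion sigma tau0 T0 (history (white_drawn I) n w))); last first.
    by apply/funext => n; exact: urn_proportionE.
  move=> cw [Th0|Th1]; first by left; right; rewrite -Th0.
  right; rewrite (_ : (fun n => _) = (fun n =>
    1 - colour_proportion sigma tau0 T0 (history (white_drawn I) n w))).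
    rewrite -(_ : 1 - Theta w = 0); last by rewrite Th1 subrr.
    by apply: cvgB => //; exact: cvg_cst.
  apply/funext => n; rewrite history_swap colour_proportion_swap//.
  exact: ltnW.
apply: negligibleU; first apply: negligibleU => //.
  exact: colour_proportion_cvg0_negligible (ltnW T0_lt) mW law sigma_to0.
exact: colour_proportion_cvg0_negligible B_le mB lawB sigma_to0.
Qed.
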